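(* For any compact metric space $X$ and any real $p\ge1$, $$\underline{\dim}(X)\le\underline{\mathrm{mo}}(\mathcal M(X),\mathsf W_p)\le\overline{\mathrm{mo}}(\mathcal M(X),\mathsf W_p)\le\overline{\dim}(X).$$ In particular, the metric order $\mathrm{mo}(\mathcal M(X),\mathsf W_p)$ exists and equals the box-counting dimension $\dim X$ whenever the latter exists.
   Context: For a (nonempty) totally bounded metric space $Y$, the covering number $D_Y(\epsilon)$ is the minimal cardinality of a set $F\subset Y$ such that $Y$ is covered by the closed $\epsilon$-balls centered at points of $F$. The lower and upper box-counting dimensions $\underline{\dim}(Y)$, $\overline{\dim}(Y)$ are the $\liminf$ and $\limsup$, as $\epsilon\to0$, of $\frac{\log D_Y(\epsilon)}{-\log\epsilon}$; if equal, the common value is $\dim Y$. The lower and upper metric orders $\underline{\mathrm{mo}}(Y)$, $\overline{\mathrm{mo}}(Y)$ are the $\liminf$ and $\limsup$, as $\epsilon\to0$, of $\frac{\log\log D_Y(\epsilon)}{-\log\epsilon}$; if equal, the common value is the metric order $\mathrm{mo}(Y)$. All values lie in $[0,\infty]$. Convention: the quotient $\frac{\log\log N}{-\log\epsilon}$ is read as $0$ when $N=1$. $\mathcal M(X)$ is the set of Borel probability measures on $(X,\mathsf d)$, and $\mathsf W_p(\mu,\nu)=\inf_\pi\left(\int_{X\times X}\mathsf d(x,y)^p\,d\pi(x,y)\right)^{1/p}$, the infimum over all probability measures $\pi$ on $X\times X$ with marginals $\mu,\nu$. *)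

(* Defs.v *)
From HB Require Import structures.
From mathcomp Require Import all_boot all_order all_algebra.
From mathcomp Require Import all_classical all_reals all_analysis.

Set Implicit Arguments.
Unset Strict Implicit.
Unset Printing Implicit Defensive.

Import Order.TTheory GRing.Theory Num.Theory.
Import numFieldNormedType.Exports.

Local Open Scope classical_set_scope.
Local Open Scope ring_scope.
Local Open Scope ereal_scope.

(* Nonempty metric spaces: measurable types are pointed in the library, so the
   Borel space of a metric space is only available over a pointed type. *)
#[short(type="pointedMetricType")]
HB.structure Definition PointedMetric (K : numDomainType) :=
  { M of Pointed M & Metric K M }.

Section covering.
Context {R : realType} {Y : Type}.

(* Distances are extended-real functions on a bare type, so that the notions
   below apply both to a metric space and to probability measures with the
   Wasserstein distance.  They are unchanged when points at distance 0 are
   identified. *)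
Implicit Type dist : Y -> Y -> \bar R.

Definition covers dist (eps : R) (F : set Y) :=
  forall y, exists2 x, F x & dist x y <= eps%:E.

(* An infimum of a set of natural numbers is a minimum if the set is nonempty;
   it is +oo if no finite set covers Y. *)
Definition covering_number dist (eps : R) : \bar R :=
  ereal_inf [set n%:R%:E | n in
    [set n : nat | exists2 F : set Y, (F #= `I_n)%card & covers dist eps F]].

Definition box_quotient dist (eps : R) : \bar R :=
  lne (covering_number dist eps) / (- ln eps)%:E.

(* lne 0 = -oo, hence the separate case of a covering number equal to 1. *)
Definition order_quotient dist (eps : R) : \bar R :=
  if covering_number dist eps == 1 then 0
  else lne (lne (covering_number dist eps)) / (- ln eps)%:E.

Definition lower_box_dim dist : \bar R := limf_einf (box_quotient dist) 0^'+.
Definition upper_box_dim dist : \bar R := limf_esup (box_quotient dist) 0^'+.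
Definition has_box_dim dist (s : \bar R) :=
  lower_box_dim dist = s /\ upper_box_dim dist = s.

Definition lower_metric_order dist : \bar R :=
  limf_einf (order_quotient dist) 0^'+.
Definition upper_metric_order dist : \bar R :=
  limf_esup (order_quotient dist) 0^'+.
Definition has_metric_order dist (s : \bar R) :=
  lower_metric_order dist = s /\ upper_metric_order dist = s.

End covering.

Definition metric_dist {R : realType} (X : metricType R) (x y : X) : \bar R :=
  (mdist x y)%:E.

Definition borel {R : realType} (X : pointedMetricType R) :
    measurableType (@open X).-sigma :=
  g_sigma_algebraType (@open X).

Section wasserstein.
Context {R : realType} (X : pointedMetricType R).

(* Values of a probability on non-Borel sets are unconstrained: probabilities
   that agree on the Borel sets need not be equal terms, but they are at
   Wasserstein distance 0, which the covering numbers do not see.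

   The product carries the product sigma-algebra, which is the Borel one of
   X * X when X is separable, in particular when X is compact. *)
Definition coupling (mu nu : probability (borel X) R) :
    set (probability (borel X * borel X)%type R) :=
  [set pi | forall A : set (borel X), measurable A ->
     pushforward pi fst A = mu A /\ pushforward pi snd A = nu A].

Definition wasserstein (p : R) (mu nu : probability (borel X) R) : \bar R :=
  ereal_inf [set (\int[pi]_z ((mdist (z.1 : X) (z.2 : X)) `^ p)%:E) `^ p^-1
            | pi in coupling mu nu].

End wasserstein.

(* Main.v *)
Require Import Defs.
From mathcomp Require Import all_boot all_order all_algebra.
From mathcomp Require Import all_classical all_reals all_analysis.
From mathcomp Require Import measurable_realfun zify ring lra.

(** Write D for the covering number of X and M for that of the probability
measures on X with the distance W_p.  Everything follows from comparing M with
an exponential of D, at scales that differ by a constant factor.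

Upper bound ([covering_number_wasserstein_le]).  Let n closed eps-balls cover X
and cut X into Borel cells A_i lying in these balls.  Given mu, move almost all
the mass of A_i to the centre of its ball, namely mu(A_i) rounded down to a
multiple of 1/k, and the remainders, of total mass at most n/k, to a fixed
base point.  The moves to the centres cost at most eps^p per unit of mass, the
others at most diam(X)^p; if k is about n (diam(X)/eps)^p the total is at most
2 eps^p, so W_p <= 2 eps.  The measure obtained is determined by n integers in
[0, k], whence M(2 eps) <= (k+1)^n.  If the upper box dimension of X is
finite then ln n, and with it ln k, is O(-ln eps); hence the double logarithm
of this bound is ln n + O(ln(-ln eps)), and the last term vanishes after
division by -ln eps.

Lower bound ([covering_number_wasserstein_ge]).  Take N >= 2 points that are
pairwise more than eps apart, where N may be any integer up to D(eps), and
group them into m = N/2 pairs.  Each choice s of one point in each pair gives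
the uniform measure mu_s on the m chosen points.  If nu is within eps/32 of
mu_s then at most 1/8 of the mass travels further than eps/2, so the nu-masses
of the balls of radius eps/2 around the chosen points add up to at least 7/8,
even if each is counted only up to 1/m ([ball_mass_coupling]).  These balls
are disjoint, so for a fixed nu an exponential moment estimate bounds the
number of such s by 2^m e^(-m/8) ([card_large_sums_le]).  Hence
M(eps/32) >= e^(m/8) >= e^(N/32), and the double logarithm is at least
ln D(eps) - O(1).

Constant factors in the scale and additive constants in the logarithms
disappear in the limit
([lower_box_dim_le_metric_order], [upper_metric_order_le_box_dim]). *)

Set Implicit Arguments.
Unset Strict Implicit.
Unset Printing Implicit Defensive.

Import Order.TTheory GRing.Theory Num.Theory.
Import numFieldNormedType.Exports.

Local Open Scope classical_set_scope.
Local Open Scope ring_scope.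

(** * Covering numbers *)

Section covering_numbers.
Context {R : realType} {Y : Type}.
Implicit Types (dist : Y -> Y -> \bar R) (eps : R).

(** The family may have repetitions: a covering number only sees its range, and
this spares the construction of sets of a prescribed cardinality. *)
Lemma covering_number_le dist eps (T : finType) (f : T -> Y) :
    (forall y, exists t, (dist (f t) y <= eps%:E)%E) ->
  (covering_number dist eps <= #|T|%:R%:E)%E.
Proof.
move=> cov; pose g (i : 'I_#|T|) := f (enum_val i).
have gF : finite_set (range g) by apply: finite_image; exact: finite_finset.
have [k kF] := gF.
apply: (@le_trans _ _ k%:R%:E).
  apply: ereal_inf_lbound; exists k => //=; exists (range g) => // y.
  have [t ft] := cov y; exists (f t) => //.
  by exists (enum_rank t) => //; rewrite /g enum_rankK.
rewrite lee_fin ler_nat -card_le_II -(card_le_eql kF).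
by rewrite (card_le_trans (card_image_le _ _))// (card_le_eqr card_II).
Qed.

Lemma covering_number_lt dist eps (t : \bar R) :
  (covering_number dist eps < t)%E -> exists n (f : 'I_n -> Y),
    (n%:R%:E < t)%E /\ forall y, exists i, (dist (f i) y <= eps%:E)%E.
Proof.
move=> /ereal_inf_lt[_ [n [F Fn cov] <-] nt].
have /card_eqVP[e] : ([set: 'I_n] #= F)%card.
  by rewrite (card_eqr Fn); exact/card_esym/card_II.
exists n, (fun i => val (e (to_setT i))); split=> // y.
have [x Fx xy] := cov y.
pose xF : set_type F := SigSub (mem_set Fx).
exists (val (e^-1%FUN xF)).
suff -> : e (to_setT (val (e^-1%FUN xF))) = xF by [].
rewrite -[RHS](@invK _ _ _ _ e) ?inE//; congr (e _).
exact: val_inj.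
Qed.

Lemma covering_number_ge1 dist eps (y0 : Y) :
  (1 <= covering_number dist eps)%E.
Proof.
rewrite leNgt; apply/negP => /covering_number_lt[[|n] [f [n1 cov]]].
  by have [[]] := cov y0.
by move: n1; rewrite lte_fin ltNge ler1n.
Qed.

(** Covering numbers are integers or infinite, so the conventional value 0 of
the order quotient is used exactly when the double logarithm would be that of a
number below 2. *)
Lemma covering_number_neq1 dist eps (y0 : Y) :
  covering_number dist eps != 1%E -> (2%:E <= covering_number dist eps)%E.
Proof.
move=> N1; rewrite leNgt; apply/negP => /covering_number_lt[n [f [n2 cov]]].
have := covering_number_ge1 dist eps y0.
rewrite le_eqVlt eq_sym (negbTE N1)/= ltNge => /negP; apply.
have := @covering_number_le dist eps _ f cov.
move=> /le_trans; apply; rewrite card_ord lee_fin.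
by move: n2; rewrite lte_fin (ltr_nat R n 2) => n2; rewrite lern1.
Qed.

End covering_numbers.

(** * Lower and upper limits at 0 *)

Section limits.
Context {R : realType}.
Implicit Types (f : R -> \bar R) (a : \bar R).

Lemma limf_einf_ge f a :
  (\forall e \near 0^'+, (a <= f e)%E) -> (a <= limf_einf f 0^'+)%E.
Proof.
move=> af; rewrite limf_einfE; apply: le_ereal_sup_tmp.
exists (ereal_inf (f @` [set e | (a <= f e)%E])).
  by exists [set e | (a <= f e)%E].
by apply: le_ereal_inf_tmp => _ [e ae <-].
Qed.

Lemma limf_esup_le f a :
  (\forall e \near 0^'+, (f e <= a)%E) -> (limf_esup f 0^'+ <= a)%E.
Proof.
move=> fa; rewrite -[limf_esup _ _]oppeK -limf_einfN leeNl.
by apply: limf_einf_ge; apply: filterS fa => e; rewrite leeN2.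
Qed.

Lemma limf_einf_gt f a :
  (a < limf_einf f 0^'+)%E -> \forall e \near 0^'+, (a < f e)%E.
Proof.
rewrite limf_einfE => /ereal_sup_gt[_ [V FV <-] aV].
apply: filterS FV => e Ve; apply: (lt_le_trans aV).
by apply: ereal_inf_lbound; exists e.
Qed.

Lemma limf_esup_lt f a :
  (limf_esup f 0^'+ < a)%E -> \forall e \near 0^'+, (f e < a)%E.
Proof.
rewrite -[limf_esup _ _]oppeK -limf_einfN lteNl => /limf_einf_gt.
by apply: filterS => e; rewrite lteN2.
Qed.

Lemma limf_einf_le_esup f : (limf_einf f 0^'+ <= limf_esup f 0^'+)%E.
Proof.
rewrite leNgt; apply/negP; rewrite {1}/limf_esup => /ereal_inf_lt[_ [V FV <-]].
move=> /limf_einf_gt Vf.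
have [e [Ve]] : exists e, V e /\ (ereal_sup (f @` V) < f e)%E.
  apply: (@filter_ex _ (0 : R)^'+); exact: filterI FV Vf.
by rewrite ltNge => /negP; apply; apply: ereal_sup_ubound; exists e.
Qed.

Lemma lee_from_below (x y : \bar R) :
  (forall r : R, (r%:E < x)%E -> (r%:E <= y)%E) -> (x <= y)%E.
Proof.
case: y => [y| |] yP; rewrite ?leey//.
  rewrite leNgt; apply/negP; case: x yP => [x| |] yP //.
    rewrite lte_fin => yx; have := yP ((x + y) / 2).
    by rewrite lte_fin lee_fin => /(_ ltac:(lra)); lra.
  by move=> _; have := yP (y + 1) (ltry _); rewrite lee_fin; lra.
case: x yP => [x| |] yP //.
  by have := yP (x - 1); rewrite lte_fin => /(_ ltac:(lra)).
by have := yP 0 (ltry _).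
Qed.

Lemma lee_from_above (x y : \bar R) :
  (forall r : R, (y < r%:E)%E -> (x <= r%:E)%E) -> (x <= y)%E.
Proof.
move=> yP; rewrite -leeN2; apply: lee_from_below => r rx.
by rewrite leeNr -EFinN; apply: yP; rewrite EFinN lteNr.
Qed.

Lemma near_rightP (P : R -> Prop) :
  (\forall e \near 0^'+, P e) <->
  exists2 d : R, 0 < d & forall e, 0 < e < d -> P e.
Proof.
split; last first.
  move=> [d d0 dP]; near=> e; apply: dP; apply/andP; split; near: e.
    exact: nbhs_right_gt.
  exact: nbhs_right_lt.
rewrite near_withinE => /nbhs_ballP[d/= d0 dP]; exists d => // e /andP[e0 ed].
by apply: dP => //; rewrite /ball/= sub0r normrN gtr0_norm.
Unshelve. all: by end_near. Qed.

Lemma near_right_scale (P : R -> Prop) c : 0 < c ->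
  (\forall e \near 0^'+, P e) -> \forall e \near 0^'+, P (e * c).
Proof.
move=> c0 /near_rightP[d d0 dP]; apply/near_rightP; exists (d / c).
  exact: divr_gt0.
by move=> e /andP[e0 ed]; apply: dP; rewrite mulr_gt0//= -ltr_pdivlMr.
Qed.

Lemma near_right_Nln (T : R) : \forall e \near 0^'+, T < - ln e.
Proof.
apply/near_rightP; exists (expR (- T)); first exact: expR_gt0.
by move=> e /andP[e0 eT]; rewrite ltrNr -ltr_expR lnK.
Qed.

End limits.

(** * Comparison of dimension and metric order *)

Section growth_rates.
Context {R : realType}.
Implicit Types (x : \bar R) (a L : R).

(** Together with its mirror image [lne_div_lee], this turns every bound on the
quotients into one on the covering numbers, with no case distinction on
infinite values. *)
Lemma lee_lne_div a L x : 0 < L ->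
  (a%:E <= lne x / L%:E)%E = ((expR (a * L))%:E <= x)%E.
Proof.
move=> L0; rewrite inver (gt_eqF L0); case: x => [r| |].
- have [r0|r0] := leP r 0.
    rewrite le0_lneNy ?lee_fin// mulNyr gtr0_sg ?invr_gt0// mul1e.
    by rewrite leNgt ltNyr/= [RHS]leNgt (le_lt_trans r0)// expR_gt0.
  by rewrite lne_EFin// -EFinM !lee_fin ler_pdivlMr// -ler_expR lnK.
- by rewrite /= mulyr gtr0_sg ?invr_gt0// mul1e !leey.
- by rewrite /= mulNyr gtr0_sg ?invr_gt0// mul1e !leNgt !ltNyr.
Qed.

Lemma lne_div_lee a L x : 0 < L ->
  (lne x / L%:E <= a%:E)%E = (x <= (expR (a * L))%:E)%E.
Proof.
move=> L0; rewrite inver (gt_eqF L0); case: x => [r| |].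
- have [r0|r0] := leP r 0.
    rewrite le0_lneNy ?lee_fin// mulNyr gtr0_sg ?invr_gt0// mul1e.
    by rewrite leNye (le_trans r0)// expR_ge0.
  by rewrite lne_EFin// -EFinM !lee_fin ler_pdivrMr// -ler_expR lnK.
- by rewrite /= mulyr gtr0_sg ?invr_gt0// mul1e !leNgt !ltry.
- by rewrite /= mulNyr gtr0_sg ?invr_gt0// mul1e !leNye.
Qed.

Lemma lee_lne_expR a x : (a%:E <= lne x)%E = ((expR a)%:E <= x)%E.
Proof.
have := @lee_lne_div a 1 x ltr01.
by rewrite inver oner_eq0 invr1 mule1 mulr1.
Qed.

Lemma lne_lee_expR a x : (lne x <= a%:E)%E = (x <= (expR a)%:E)%E.
Proof.
have := @lne_div_lee a 1 x ltr01.
by rewrite inver oner_eq0 invr1 mule1 mulr1.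
Qed.

End growth_rates.

Section metric_order_bounds.
Context {R : realType} {Y Z : Type}.
Variables (dY : Y -> Y -> \bar R) (dZ : Z -> Z -> \bar R) (z0 : Z) (y0 : Y).

(** The quotient itself may be negative, since ln (ln 2) < 0, but it is bounded
below by ln (ln 2) / (- ln e), which tends to 0. *)
Lemma lower_metric_order_ge0 : (0 <= lower_metric_order dZ)%E.
Proof.
apply: lee_from_below => a; rewrite lte_fin => a0.
apply: limf_einf_ge; near=> e.
have L0 : 0 < - ln e by near: e; exact: near_right_Nln.
rewrite /order_quotient; case: ifPn => [_|M1]; first by rewrite lee_fin ltW.
rewrite lee_lne_div// lee_lne_expR (le_trans _ (covering_number_neq1 z0 M1))//.
rewrite lee_fin -[leRHS]lnK ?posrE// ler_expR.
rewrite -[leRHS]lnK ?posrE ?ln_gt0 ?ltr1n//.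
rewrite ler_expR -ler_ndivrMl//; apply: ltW.
by near: e; exact: near_right_Nln.
Unshelve. all: by end_near. Qed.

Lemma upper_box_dim_ge0 : (0 <= upper_box_dim dY)%E.
Proof.
apply: le_trans (limf_einf_le_esup _); apply: limf_einf_ge; near=> e.
have L0 : 0 < - ln e by near: e; exact: near_right_Nln.
by rewrite lee_lne_div// mul0r expR0; exact: covering_number_ge1.
Unshelve. all: by end_near. Qed.

(** Let a < b < lower_box_dim and L = - ln e.  At the scale c e the covering
number of Y exceeds exp (b (L - ln c)), so that of Z at the scale e has a double
logarithm of at least b L - O(1), which is at least a L for large L. *)
Lemma lower_box_dim_le_metric_order (c : R) (c1 : 1 <= c)
    (d : R) (d1 : 1 <= d) :
  (forall (eps : R) (N : nat), 0 < eps -> (2 <= N)%N ->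
     (N%:R%:E <= covering_number dY eps)%E ->
     ((expR (N%:R / d))%:E <= covering_number dZ (eps / c))%E) ->
  (lower_box_dim dY <= lower_metric_order dZ)%E.
Proof.
move=> MN; apply: lee_from_below => a aX.
have [a0|a0] := ltP a 0.
  by apply: le_trans lower_metric_order_ge0; rewrite lee_fin ltW.
have [b /andP[ab bX]] : exists b : R, (a%:E < b%:E < lower_box_dim dY)%E.
  case: (lower_box_dim dY) aX => [r| |//]; rewrite ?lte_fin => ar.
    by exists ((a + r) / 2); rewrite !lte_fin; lra.
  by exists (a + 1); rewrite ltry andbT lte_fin ltrDl.
rewrite lte_fin in ab.
have b0 : 0 < b by exact: le_lt_trans ab.
have c0 : 0 < c by lra.
have d0 : 0 < d by lra.
apply: limf_einf_ge; near=> e.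
have e0 : 0 < e by near: e; exact: nbhs_right_gt.
have L0 : 0 < - ln e by near: e; exact: near_right_Nln.
have L'E : - ln (e * c) = - ln e - ln c by rewrite lnM ?posrE// opprD.
have LT1 : (ln (2 * d) + b * ln c) / (b - a) < - ln e.
  by near: e; exact: near_right_Nln.
have LT2 : b^-1 + ln c < - ln e by near: e; exact: near_right_Nln.
have L'1 : b^-1 < - ln (e * c) by rewrite L'E; lra.
have L'0 : 0 < - ln (e * c) by apply: lt_trans L'1; rewrite invr_gt0.
have bX' : (b%:E < box_quotient dY (e * c))%E.
  near: e.
  apply: (@near_right_scale _ (fun e => b%:E < box_quotient dY e)%E) => //.
  exact: limf_einf_gt.
have {bX'}DE : ((expR (b * - ln (e * c)))%:E <= covering_number dY (e * c))%E.
  by rewrite -lee_lne_div// ltW.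
set E := expR _ in DE.
have E2 : 2 <= E.
  rewrite /E (le_trans _ (expR_ge1Dx _))//.
  suff : 1 <= b * - ln (e * c) by lra.
  by rewrite -ler_pdivrMl// mulr1 ltW.
have E0 : 0 <= E by lra.
have /andP[NE EN] := truncn_itv E0.
(* N is an integer, large enough as N + 1 > E and N >= 2 give N >= E / 2. *)
set N := Num.truncn E in NE EN.
have N2 : (2 <= N)%N.
  have : 2%:R < N.+1%:R :> R by exact: le_lt_trans E2 EN.
  by rewrite ltr_nat.
have := MN (e * c) N (mulr_gt0 e0 c0) N2.
rewrite mulfK ?gt_eqF// (le_trans _ DE) ?lee_fin// => /(_ isT) MN'.
have N2R : 2 <= N%:R :> R by rewrite (ler_nat R 2).
have N0 : 0 < N%:R / d by rewrite divr_gt0//; lra.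
rewrite /order_quotient gt_eqF; last first.
  by apply: lt_le_trans MN'; rewrite lte_fin expR_gt1.
rewrite lee_lne_div// lee_lne_expR (le_trans _ MN')// lee_fin ler_expR.
rewrite ler_pdivlMr//.
apply: (@le_trans _ _ (E / 2)); last first.
  have : E < N%:R + 1 by move: EN; rewrite -natr1.
  lra.
rewrite ler_pdivlMr// -mulrA.
rewrite -[X in _ * X]lnK; last by rewrite posrE; lra.
rewrite -expRD /E ler_expR [d * 2]mulrC L'E.
move: LT1; rewrite ltr_pdivrMr; last lra.
lra.
Unshelve. all: by end_near. Qed.

(** Let upper_box_dim < b < a and L = - ln e.  With n at most about exp (b L)
and k about n C / eps ^ p, the logarithm of (k + 1) ^ n is at most n X, where X
is affine in L.  The bound X <= exp (s X) / s, with s so small that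
s X <= (a - b) L / 2 up to a constant, absorbs the factor X. *)
Lemma upper_metric_order_le_box_dim (C p : R) : 1 <= C -> 1 <= p ->
  (forall (eps : R) (n k : nat) (f : 'I_n -> Y), 0 < eps -> (0 < k)%N ->
     (forall y, exists i, (dY (f i) y <= eps%:E)%E) ->
     n%:R * C <= k%:R * eps `^ p ->
     (covering_number dZ (2 * eps) <= (k.+1%:R ^+ n)%:E)%E) ->
  (upper_metric_order dZ <= upper_box_dim dY)%E.
Proof.
move=> C1 p1 MN; apply: lee_from_above => a aX.
have X0 := upper_box_dim_ge0.
have [b /andP[bX ba]] : exists b : R, (upper_box_dim dY < b%:E < a%:E)%E.
  case: (upper_box_dim dY) aX X0 => [r| |]//; rewrite ?lte_fin => ra _.
  by exists ((a + r) / 2); rewrite !lte_fin; lra.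
have b0 : 0 < b by move: (le_lt_trans X0 bX); rewrite lte_fin.
rewrite lte_fin in ba.
have a0 : 0 < a by lra.
pose s := (a - b) / 2 / (b + p).
have bp0 : 0 < b + p by lra.
have s0 : 0 < s by rewrite divr_gt0//; lra.
pose K := b * ln 2 + (a - b) / 2 * ln 2 + s * ln (C + 2) - ln s.
apply: limf_esup_le; near=> e.
have e0 : 0 < e by near: e; exact: nbhs_right_gt.
have L0 : 0 < - ln e by near: e; exact: near_right_Nln.
have L'E : - ln (e * 2^-1) = - ln e + ln 2.
  by rewrite lnM ?posrE// lnV ?posrE// opprB addrC.
have LK : K / ((a - b) / 2) < - ln e by near: e; exact: near_right_Nln.
have l2 : 0 < ln 2 :> R by rewrite ln_gt0// ltr1n.
have L'0 : 0 < - ln (e * 2^-1) by rewrite L'E addr_gt0.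
rewrite /order_quotient; case: ifPn => [_|M1]; first by rewrite lee_fin ltW.
rewrite lne_div_lee// lne_lee_expR.
have bX' : (box_quotient dY (e * 2^-1) < b%:E)%E.
  near: e; apply: (@near_right_scale _ (fun e => box_quotient dY e < b%:E)%E).
    by rewrite invr_gt0.
  exact: limf_esup_lt.
set eps := e * 2^-1 in L'E L'0 bX'.
have eps0 : 0 < eps by rewrite mulr_gt0// invr_gt0.
have eE : e = 2 * eps by rewrite /eps mulrCA divff// mulr1.
have : (covering_number dY eps < (expR (b * - ln eps))%:E)%E.
  by rewrite ltNge -lee_lne_div// -ltNge.
move=> /covering_number_lt[n [f [nE cov]]]; rewrite lte_fin in nE.
(* The assumed bound requires k >= Q and k > 0; k is taken to be truncn Q + 1. *)
pose Q := n%:R * C / eps `^ p.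
have ep0 : 0 < eps `^ p by exact: powR_gt0.
have Q0 : 0 <= Q by rewrite divr_ge0 ?mulr_ge0 ?(ltW ep0)//; lra.
have /andP[kQ Qk] := truncn_itv Q0.
have := MN eps n (Num.truncn Q).+1 f eps0 isT cov.
rewrite -ler_pdivrMr// => /(_ (ltW Qk)); rewrite -eE => /le_trans; apply.
pose X := (b + p) * - ln eps + ln (C + 2).
have kX : (Num.truncn Q).+2%:R <= expR X.
  rewrite /X expRD lnK ?posrE; last lra.
  rewrite -addn2 natrD.
  have E1 : 1 <= expR ((b + p) * - ln eps).
    by rewrite -expR0 ler_expR mulr_ge0 ?ltW.
  have QE : Q <= expR ((b + p) * - ln eps) * C.
    rewrite /Q mulrAC; apply: ler_wpM2r; first by lra.
    rewrite mulrDl expRD; apply: ler_pM; rewrite ?invr_ge0 ?powR_ge0//.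
      exact: ltW.
    by rewrite /powR gt_eqF// mulrN expRN.
  nra.
rewrite lee_fin (le_trans (_ : _ <= expR X ^+ n))//.
  by rewrite lerXn2r ?nnegrE// expR_ge0.
rewrite -expRM_natl ler_expR.
have X0' : 0 <= X.
  rewrite /X addr_ge0 ?(mulr_ge0 (ltW bp0) (ltW L'0))// ln_ge0//; lra.
apply: (@le_trans _ _ (expR (b * - ln eps) * (expR (s * X) / s))).
  apply: ler_pM => //; first exact: ltW.
  by rewrite ler_pdivlMr// mulrC (le_trans _ (expR_ge1Dx _))// lerDr.
rewrite mulrA -expRD -[X in _ / X]lnK ?posrE// -expRN -expRD ler_expR.
have -> : s * X = (a - b) / 2 * - ln eps + s * ln (C + 2).
  by rewrite /s /X; field; rewrite gt_eqF.
rewrite L'E; move: LK; rewrite ltr_pdivrMr; last lra.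
rewrite /K; lra.
Unshelve. all: by end_near. Qed.

End metric_order_bounds.

(** * Counting choices with a large sum *)

Section counting.
Context {R : realType}.

(** For a large sum, the product of the 1 + f i (s i) is at least 2^m e^(-m/8).
Summed over all s these products factor into the product of the
2 + f i true + f i false, which is at most 3^m since these numbers have mean at
most 3.  As 3 <= 4 e^(-1/4), the quotient of the two bounds is as stated. *)
Lemma card_large_sums_le m (f : 'I_m -> bool -> R) :
    (forall i b, 0 <= f i b <= 1) ->
    \sum_i (f i true + f i false) <= m%:R ->
  #|[set s : {ffun 'I_m -> bool} | 7 / 8 * m%:R <= \sum_i f i (s i)]%SET|%:R
    <= 2 ^+ m * expR (- (m%:R / 8)) :> R.
Proof.
move=> f01 fm.
set S := finset _.
have prod_const (c : R) : \prod_(i < m) c = c ^+ m.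
  by rewrite prodr_const card_ord.
have expR_sum (g : 'I_m -> R) : \prod_i expR (g i) = expR (\sum_i g i).
  by rewrite [RHS]expR_sum.
(* 1 + f >= 2 exp (f - 1) on [0, 1], since exp (1 - f) >= 2 - f and
   (1 + f) (2 - f) >= 2 there. *)
have lb s : s \in S -> 2 ^+ m * expR (- (m%:R / 8)) <= \prod_i (1 + f i (s i)).
  rewrite inE => sm.
  apply: (@le_trans _ _ (\prod_(i < m) (2 * expR (f i (s i) - 1)))).
    rewrite big_split/= prod_const expR_sum ler_pM2l ?exprn_gt0//.
    rewrite ler_expR big_split/= sumrN big_const_ord iter_addr addr0; lra.
  apply: ler_prod => i _; rewrite mulr_ge0 ?expR_ge0//=.
  have /andP[f0 f1] := f01 i (s i).
  have := expR_ge1Dx (1 - f i (s i)); rewrite -[f i (s i) - 1]opprB expRN => e1.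
  rewrite ler_pdivrMr ?expR_gt0//; nra.
(* 2 + t <= 3 exp ((t - 1) / 3), and the exponents add up to at most 0. *)
have ub : \sum_(s : {ffun 'I_m -> bool}) \prod_i (1 + f i (s i)) <= 3 ^+ m :> R.
  rewrite -(bigA_distr_bigA (fun i b => 1 + f i b)).
  apply: (@le_trans _ _
    (\prod_(i < m) (3 * expR ((f i true + f i false - 1) / 3)))).
    apply: ler_prod => i _; rewrite big_bool/=.
    have /andP[f0 f1] := f01 i true; have /andP[g0 g1] := f01 i false.
    apply/andP; split; first lra.
    have := expR_ge1Dx ((f i true + f i false - 1) / 3); lra.
  rewrite big_split/= prod_const expR_sum ler_piMr ?exprn_ge0//.
  rewrite expR_le1 -mulr_suml pmulr_lle0 ?invr_gt0//.
  by rewrite big_split/= sumrN big_const_ord iter_addr addr0 subr_le0.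
have count : #|S|%:R * (2 ^+ m * expR (- (m%:R / 8))) <= 3 ^+ m :> R.
  apply: (le_trans _ ub); rewrite mulr_natl -sumr_const.
  apply: (@le_trans _ _ (\sum_(s in S) \prod_i (1 + f i (s i)))).
    exact: ler_sum.
  rewrite [leRHS](bigID (mem S))/= lerDl; apply: sumr_ge0 => s _.
  by apply: prodr_ge0 => i _; have /andP[? _] := f01 i (s i); lra.
rewrite -(ler_pM2r (_ : 0 < 2 ^+ m * expR (- (m%:R / 8)))); last first.
  by rewrite mulr_gt0 ?exprn_gt0 ?expR_gt0.
apply: le_trans count _.
rewrite mulrACA -exprMn -expRD.
have -> : expR (- (m%:R / 8) - m%:R / 8) = expR (- 4^-1) ^+ m :> R.
  by rewrite -expRM_natl; congr expR; field.
rewrite -exprMn lerXn2r ?nnegrE ?mulr_ge0 ?expR_ge0//.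
have := expR_ge1Dx (- 4^-1 : R); lra.
Qed.

End counting.

(** * Compact metric spaces *)

Section compact_metric.
Context {R : realType} (X : pointedMetricType R) (cptX : compact [set: X]).

Lemma finite_net (e : R) : 0 < e ->
  exists s : seq X, forall x, exists2 y, y \in s & mdist y x < e.
Proof.
move=> e0; have : cover_compact [set: X] by rewrite -compact_cover.
move=> /(_ X setT (fun x => (ball x e)^°))[x _|x _|D _ cov].
- exact: open_interior.
- by exists x => //; exact: nbhsx_ballx.
- exists (finmap.enum_fset D) => x; have [//|y yD yx] := cov x; exists y => //.
  by move/interior_subset: yx; rewrite ballEmdist.
Qed.

Lemma bounded_mdist : exists2 D : R, 1 <= D & forall x y : X, mdist x y <= D.
Proof.
have [s sP] := finite_net ltr01.
exists (1 + (1 + \sum_(y <- s) mdist y point) *+ 2) => [|x y].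
  rewrite lerDl mulrn_wge0// addr_ge0// sumr_ge0// => y _.
  exact: mdist_ge0.
have bnd (z : X) : mdist z point <= 1 + \sum_(y <- s) mdist y (point : X).
  have [w ws wz] := sP z.
  rewrite (le_trans (metric_triangle _ w _))// lerD//.
    by rewrite metric_sym ltW.
  by rewrite (big_rem w)//= lerDl sumr_ge0// => v _; exact: mdist_ge0.
rewrite (le_trans (metric_triangle _ point _))// [mdist point y]metric_sym.
by have := bnd x; have := bnd y; rewrite mulr2n; lra.
Qed.

Lemma dense_sequence : exists z : nat -> X,
  forall x (e : R), 0 < e -> exists n, mdist (z n) x < e.
Proof.
have /choice[s sP] : forall n, exists s : seq X,
    forall x, exists2 y, y \in s & mdist y x < n.+1%:R^-1.
  by move=> n; exact: finite_net.
exists (fun n =>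
  if unpickle n is Some (i, j) then nth point (s i) j else point).
move=> x e e0.
have [n ne] : exists n, n.+1%:R^-1 < e.
  by have [n] := ltr_add_invr (e0 : 0 < e); rewrite add0r; exists n.
have [y ys yx] := sP n x.
exists (pickle (n, index y (s n))); rewrite pickleK nth_index//.
exact: lt_trans ne.
Qed.

Lemma open_mdist_lt (z : X) r : open [set x : X | mdist x z < r].
Proof.
rewrite openE => x /= xz; apply/nbhs_ballP; exists (r - mdist x z) => /=.
  by rewrite subr_gt0.
move=> y; rewrite ballEmdist/= ltrBrDr => yx.
by rewrite (le_lt_trans (metric_triangle _ x _))// [mdist y x]metric_sym.
Qed.

Lemma measurable_fun_ltP d (T : measurableType d) (f : T -> R) :
  (forall r, measurable [set x | f x < r]) -> measurable_fun [set: T] f.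
Proof.
move=> mf; apply: (@measurability _ _ _ _ _ _ _ (RGenInftyO.measurableE R)).
move=> _ [_ [r ->] <-]; by rewrite setTI; exact: mf.
Qed.

Lemma measurable_mdistr (z : X) :
  measurable_fun [set: borel X] (fun x : borel X => mdist (x : X) z).
Proof.
apply: measurable_fun_ltP => r.
by apply: sub_sigma_algebra; exact: open_mdist_lt.
Qed.

(** The product sigma-algebra need not contain all open sets of X * X when X is
not separable.  With a dense sequence z, the distance of x and y is less than r
if and only if the detour through some z n is. *)
Lemma measurable_mdist : measurable_fun [set: (borel X * borel X)%type]
  (fun w => mdist (w.1 : X) (w.2 : X)).
Proof.
have [z zP] := dense_sequence.
apply: measurable_fun_ltP => r.
have -> : [set w : borel X * borel X | mdist (w.1 : X) (w.2 : X) < r] =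
    \bigcup_n [set w | mdist (w.1 : X) (z n) + mdist (w.2 : X) (z n) < r].
  apply/seteqP; split=> [[x y]/= xy|[x y] [n _]/=].
    have [|n nx] := zP x ((r - mdist x y) / 2).
      by rewrite divr_gt0 ?subr_gt0.
    exists n => //=; rewrite metric_sym in nx.
    have := metric_triangle y x (z n); rewrite [mdist y x]metric_sym; lra.
  by apply: le_lt_trans; rewrite [mdist y _]metric_sym metric_triangle.
apply: bigcup_measurable => n _; rewrite -[X in measurable X]setTI.
have mf : measurable_fun [set: (borel X * borel X)%type]
    (fun w => mdist (w.1 : X) (z n) + mdist (w.2 : X) (z n)).
  apply: measurable_funD.
    exact: (measurableT_comp (measurable_mdistr (z n)) measurable_fst).
  exact: (measurableT_comp (measurable_mdistr (z n)) measurable_snd).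
exact: mf measurableT _ (measurable_itv `]-oo, r[%R).
Qed.

End compact_metric.

(** * Wasserstein distance and mass moved far *)

Section wasserstein_distance.
Context {R : realType} (X : pointedMetricType R) (cptX : compact [set: X]).
Implicit Types mu nu : probability (borel X) R.

Definition far_pairs (r : R) : set (borel X * borel X)%type :=
  [set w | r < mdist (w.1 : X) (w.2 : X)].

Let dist (w : borel X * borel X) : R := mdist (w.1 : X) (w.2 : X).

Lemma measurable_far_pairs (r : R) : measurable (far_pairs r).
Proof.
have := measurable_mdist cptX measurableT (measurable_itv `]r, +oo[%R).
rewrite setTI; congr measurable.
by apply/seteqP; split=> w /=; rewrite in_itv/= andbT.
Qed.

Let measurable_cost (p : R) :
  measurable_fun setT (fun w : borel X * borel X => (dist w `^ p)%:E).
Proof.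
apply/measurable_EFinP.
exact: (measurableT_comp (measurable_powR _) (measurable_mdist cptX)).
Qed.

(** The cost is at most eps ^ p plus D ^ p times the mass moved further than
eps, hence at most 2 eps ^ p <= (2 eps) ^ p. *)
Lemma wasserstein_le (p D eps : R) nu mu (pi : probability _ R) :
    1 <= p -> 0 < eps -> (forall x y : X, mdist x y <= D) -> 0 <= D ->
    coupling nu mu pi ->
    (pi (far_pairs eps) * (D `^ p)%:E
       <= (eps `^ p)%:E)%E ->
  (wasserstein p nu mu <= (2 * eps)%:E)%E.
Proof.
move=> p1 eps0 dD D0 cpl far.
have p0 : 0 < p by lra.
set E := far_pairs eps in far.
have mE : measurable E by exact: measurable_far_pairs.
apply: (@le_trans _ _ ((\int[pi]_z (dist z `^ p)%:E) `^ p^-1)%E).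
  by apply: ereal_inf_lbound; exists pi.
have -> : (2 * eps)%:E = ((((2 * eps) `^ p)%:E) `^ p^-1)%E :> \bar R.
  by rewrite poweR_EFin -powRrM divff ?gt_eqF// powRr1//; lra.
apply: gt0_ler_poweR; rewrite ?in_itv/= ?leey ?andbT ?invr_ge0 ?(ltW p0)//.
- by apply: integral_ge0 => w _; rewrite lee_fin powR_ge0.
- by rewrite lee_fin powR_ge0.
apply: (@le_trans _ _
  (\int[pi]_z ((eps `^ p)%:E + (D `^ p)%:E * (\1_E z)%:E))%E).
  apply: ge0_le_integral => //.
  - by move=> w _; rewrite lee_fin powR_ge0.
  - apply/measurable_EFinP; apply: measurable_funD => //.
    by apply: measurable_funM => //; exact: measurable_indic.
  - move=> w _; rewrite -EFinM -EFinD lee_fin indicE.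
    have [wE|wE] := boolP (w \in E).
      rewrite mulr1 (le_trans (_ : _ <= D `^ p))// ?lerDr ?powR_ge0//.
      by apply: ge0_ler_powR; rewrite ?nnegrE ?(ltW p0)// /dist ?mdist_ge0.
    rewrite mulr0 addr0; apply: ge0_ler_powR;
      rewrite ?nnegrE ?(ltW p0) ?(ltW eps0) /dist ?mdist_ge0//.
    by move: wE; rewrite notin_setE /E /far_pairs/= => /negP; rewrite -leNgt.
rewrite ge0_integralD//=; last 3 first.
- by move=> w _; rewrite lee_fin powR_ge0.
- by move=> w _; rewrite lee_fin mulr_ge0 ?powR_ge0.
- apply/measurable_EFinP.
  by apply: measurable_funM => //; exact: measurable_indic.
rewrite integral_cst//.
rewrite [X in (X + _)%E](_ : _ = (eps `^ p)%:E); last first.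
  by rewrite -[RHS]mule1; congr (_ * _)%E; exact: probability_setT.
rewrite ge0_integralZl//; last 2 first.
- by apply/measurable_EFinP; exact: measurable_indic.
- by rewrite lee_fin powR_ge0.
rewrite integral_indic// setIT muleC.
apply: (@le_trans _ _ ((eps `^ p)%:E + (eps `^ p)%:E)%E); first exact: leeD2l.
rewrite -EFinD lee_fin powRM ?(ltW eps0)//.
have h1 : (2 : R) <= 2 `^ p by apply: le1r_powR => //; rewrite ler1n.
by have := ler_wpM2r (powR_ge0 eps p) h1; rewrite mulr_natl mulr2n.
Qed.

(** Markov's inequality bounds the mass by (eta / r) ^ p; the exponent is
dropped as p >= 1. *)
Lemma wasserstein_lt (p r eta : R) nu mu :
    1 <= p -> 0 < eta <= r -> (wasserstein p nu mu < eta%:E)%E ->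
  exists2 pi, coupling nu mu pi &
    (pi (far_pairs r) <= (eta / r)%:E)%E.
Proof.
move=> p1 /andP[eta0 etar] /ereal_inf_lt[_ [pi cpl <-] cost].
have p0 : 0 < p by lra.
have r0 : 0 < r by lra.
exists pi => //; set E := far_pairs r.
have mE : measurable E by exact: measurable_far_pairs.
have I0 : (0 <= \int[pi]_z (dist z `^ p)%:E)%E.
  by apply: integral_ge0 => w _; rewrite lee_fin powR_ge0.
have {}cost : (\int[pi]_z (dist z `^ p)%:E <= (eta `^ p)%:E)%E.
  rewrite -[leLHS]poweRe1// -(mulVf (lt0r_neq0 p0)) poweRrM -poweR_EFin.
  apply: gt0_ler_poweR; rewrite ?in_itv/= ?leey ?andbT ?poweR_ge0 ?lee_fin;
    by rewrite ?(ltW p0) ?(ltW eta0) ?(ltW cost).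
have rE : ((r `^ p)%:E * pi E <= (eta `^ p)%:E)%E.
  apply: le_trans cost.
  have -> : ((r `^ p)%:E * pi E = \int[pi]_z ((r `^ p)%:E * (\1_E z)%:E))%E.
    rewrite ge0_integralZl//; last 2 first.
    - by apply/measurable_EFinP; exact: measurable_indic.
    - by rewrite lee_fin powR_ge0.
    by rewrite integral_indic// setIT.
  apply: ge0_le_integral => //.
  - by move=> w _; rewrite lee_fin mulr_ge0 ?powR_ge0.
  - apply/measurable_EFinP.
    by apply: measurable_funM => //; exact: measurable_indic.
  - move=> w _; rewrite -EFinM lee_fin indicE.
    have [wE|wE] := boolP (w \in E); last by rewrite mulr0 powR_ge0.
    rewrite mulr1; apply: ge0_ler_powR;
      rewrite ?nnegrE ?(ltW p0) ?(ltW r0) /dist ?mdist_ge0//.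
    by move: wE; rewrite inE => /ltW.
rewrite -lee_pdivlMl ?powR_gt0// -EFinM in rE.
apply: (le_trans rE); rewrite lee_fin mulrC.
rewrite -(@powRr1 _ (eta / r)); last by rewrite divr_ge0 ?(ltW eta0) ?(ltW r0).
have -> : eta `^ p / r `^ p = (eta / r) `^ p.
  rewrite powRM ?invr_ge0 ?(ltW eta0) ?(ltW r0)//; congr (_ * _).
  by rewrite -(powR_inv1 (ltW r0)) powRAC powR_inv1 ?powR_ge0.
apply: ger_powR => //; rewrite divr_gt0//= ler_pdivrMr ?mul1r//.
Qed.

End wasserstein_distance.

(** * Finite sums of measures *)

Section finite_unions.
Context {R : realType} d (T : measurableType d).
Variable mu : {measure set T -> \bar R}.
Context (I : finType) (F : I -> set T).
Hypothesis mF : forall i, measurable (F i).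

Let fsum_finType : \sum_(i \in [set: I]) mu (F i) = (\sum_i mu (F i))%E.
Proof.
rewrite (_ : setT = [set` index_enum I]); last first.
  by apply/seteqP; split=> i //= _; exact: mem_index_enum.
by rewrite -fsbig_seq// index_enum_uniq.
Qed.

Lemma measure_bigcup_finType : trivIset setT F ->
  mu (\bigcup_i F i) = (\sum_i mu (F i))%E.
Proof.
by move=> tF; rewrite measure_fin_bigcup ?fsum_finType//; exact: finite_finset.
Qed.

Lemma measure_le_sum_finType (A : set T) : measurable A ->
  A `<=` \bigcup_i F i -> (mu A <= \sum_i mu (F i))%E.
Proof.
move=> mA AF; rewrite -fsum_finType; apply: content_sub_fsum => //.
exact: finite_finset.
Qed.

End finite_unions.

(** Normalizing a measure of total mass 1 does not change it; this packs
measures built from sums, scalings and images as probabilities. *)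
Lemma measure_is_probability {R : realType} d (T : measurableType d)
    (P0 : probability T R) (mu : {measure set T -> \bar R}) :
  mu setT = 1%E -> exists P : probability T R, forall A, P A = mu A.
Proof.
move=> mu1; exists (mnormalize mu P0) => A /=.
rewrite /mnormalize mu1 onee_eq0/=.
by rewrite invr1 mule1.
Qed.

Lemma uniform_probability {R : realType} d (T : measurableType d) m
    (x : 'I_m.+1 -> T) :
  exists P : probability T R,
    forall A, P A = (m.+1%:R^-1%:E * \sum_i \d_(x i) A)%E.
Proof.
have r0 : 0 <= m.+1%:R^-1 :> R by [].
pose mu : {measure set T -> \bar R} :=
  mscale (NngNum r0) (msum (fun k => \d_(x (inord k))) m.+1).
have muE A : mu A = (m.+1%:R^-1%:E * \sum_i \d_(x i) A)%E.
  rewrite /mu /mscale /msum/=; congr (_ * _)%E.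
  by apply: eq_bigr => i _; rewrite inord_val.
have mu1 : mu setT = 1%E.
  rewrite muE; under eq_bigr do rewrite diracT.
  by rewrite sumEFin sumr_const card_ord -EFinM mulVf.
have [P PE] := measure_is_probability \d_(x ord0) mu1.
by exists P => A; rewrite PE muE.
Qed.

(** * Lower bound for the covering numbers of the probability measures *)

Section lower_bound.
Context {R : realType} (X : pointedMetricType R) (cptX : compact [set: X]).

(** Greedy choice: fewer than N points do not cover X, so a further point is
more than eps away from all of them. *)
Lemma separated_sequence (eps : R) N : 0 < eps ->
    (N%:R%:E <= covering_number (@metric_dist R X) eps)%E ->
  exists x : nat -> X, forall i j, (i < j < N)%N -> eps < mdist (x i) (x j).
Proof.
move=> eps0 ND.
suff [s [sN sP]] : exists s : seq X,
    size s = N /\ pairwise (fun x y => eps < mdist x y) s.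
  exists (nth point s) => i j /andP[ij jN].
  by move/(pairwiseP point) : sP => -> //; rewrite inE sN// (ltn_trans ij).
elim: N ND => [|k IH] kD; first by exists [::].
have [|s [sk sP]] := IH.
  by apply: le_trans kD; rewrite lee_fin ler_nat.
suff [y sy] : exists y, all (fun x => eps < mdist y x) s.
  by exists (y :: s); rewrite /= sk sy.
apply: contrapT => /forallNP cov.
have cov' y : exists t : 'I_k, (metric_dist (nth point s t) y <= eps%:E)%E.
  have /negP/allPn[x xs] := cov y.
  rewrite -leNgt => yx; have xk : (index x s < k)%N by rewrite -sk index_mem.
  exists (Ordinal xk).
  by rewrite /= nth_index// /metric_dist metric_sym lee_fin.
have := le_trans kD (covering_number_le cov').
by rewrite card_ord lee_fin ler_nat ltnn.
Qed.

Section one_coupling.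
Variables (m : nat) (x : 'I_m.+1 -> bool -> X) (eps p : R).
Hypotheses (eps0 : 0 < eps) (p1 : 1 <= p).
Hypothesis sep :
  forall i b j c, (i, b) != (j, c) -> eps < mdist (x i b) (x j c).

Let B i b : set (borel X) := [set y | mdist (y : X) (x i b) <= eps / 2].

Let mB i b : measurable (B i b).
Proof.
have := measurable_mdistr (x i b) measurableT
  (measurable_itv `]-oo, eps / 2]%R).
by rewrite setTI.
Qed.

(** The mass, in units of 1/m.+1, that nu can hand over to a point mass 1/m.+1
at x i b without moving it by more than eps / 2. *)
Definition ball_mass (nu : probability (borel X) R) i b : R :=
  Num.min 1 (m.+1%:R * fine (nu (B i b))).

Lemma ball_mass_01 nu i b : 0 <= ball_mass nu i b <= 1.
Proof.
by rewrite /ball_mass le_min ler01 ge_min lexx mulr_ge0// fine_ge0.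
Qed.

(** The balls are disjoint because their centres are more than eps apart. *)
Lemma sum_ball_mass nu :
  \sum_i (ball_mass nu i true + ball_mass nu i false) <= m.+1%:R.
Proof.
pose F (ib : 'I_m.+1 * bool) := B ib.1 ib.2.
have mF ib : measurable (F ib) by exact: mB.
have tF : trivIset setT F.
  move=> [i b] [j c] _ _ [y [/= yi yj]]; apply/eqP/negPn/negP => /sep.
  apply/negP; rewrite -leNgt (le_trans (metric_triangle _ y _))//.
  by rewrite metric_sym; move: yi yj; rewrite /F /B/=; lra.
have nu1 : \sum_ib fine (nu (F ib)) <= 1.
  rewrite -lee_fin -sumEFin.
  under eq_bigr do rewrite fineK ?fin_num_measure//.
  rewrite -measure_bigcup_finType// probability_le1//.
  by apply: fin_bigcup_measurable => //; exact: finite_finset.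
apply: (@le_trans _ _ (\sum_i \sum_b m.+1%:R * fine (nu (B i b)))).
  apply: ler_sum => i _.
  by rewrite big_bool/= lerD// /ball_mass ge_min lexx orbT.
by rewrite pair_big/= -mulr_sumr ler_piMr.
Qed.

Variable s : {ffun 'I_m.+1 -> bool}.
Variable P : probability (borel X) R.
Hypothesis PE : forall A,
  P A = (m.+1%:R^-1%:E * \sum_i \d_(x i (s i) : borel X) A)%E.

Let closed1 (y : X) : measurable [set y : borel X].
Proof.
have := measurable_mdistr y measurableT (measurable_itv `]-oo, 0%R]%R).
rewrite setTI; congr measurable.
apply/seteqP; split=> z /=; rewrite in_itv/=.
  by move=> z0; apply: mdist_positivity; apply/eqP; rewrite eq_le z0 mdist_ge0.
by move=> ->; rewrite mdistxx.
Qed.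

(** A coupling at cost below eps / 16 moves at most 1/8 of the mass further than
eps / 2.  All other pairs (y, z) have z among the chosen points and y in the
ball around z, and the mass of the pairs with z = x i (s i) is bounded by either
marginal. *)
Lemma ball_mass_coupling (nu : probability (borel X) R) :
  (wasserstein p nu P <= (eps / 32)%:E)%E ->
  7 / 8 * m.+1%:R <= \sum_i ball_mass nu i (s i).
Proof.
move=> W.
have [||pi cpl far] := @wasserstein_lt _ _ cptX p (eps / 2) (eps / 16) nu P p1.
- by apply/andP; split; move: eps0; lra.
- by apply: (le_lt_trans W); rewrite lte_fin; move: eps0; lra.
have {}far : (pi (far_pairs (eps / 2)) <= (8^-1)%:E)%E.
  have <- : eps / 16 / (eps / 2) = 8^-1 by field; rewrite gt_eqF.
  exact: far.
pose S := \bigcup_i [set x i (s i) : borel X].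
have mS : measurable S.
  by apply: fin_bigcup_measurable => //; exact: finite_finset.
have PS : P (~` S) = 0%E.
  rewrite PE big1 ?mule0// => i _; rewrite diracE memNset//=.
  by apply; exists i.
pose C i : set (borel X * borel X) :=
  fst @^-1` (B i (s i)) `&` snd @^-1` [set x i (s i) : borel X].
have mfst A : measurable A ->
    measurable (fst @^-1` A : set (borel X * borel X)).
  by move=> mA; rewrite -[X in measurable X]setTI; exact: measurable_fst.
have msnd A : measurable A ->
    measurable (snd @^-1` A : set (borel X * borel X)).
  by move=> mA; rewrite -[X in measurable X]setTI; exact: measurable_snd.
have mC i : measurable (C i) by apply: measurableI; [exact: mfst|exact: msnd].
have Cle i : (pi (C i) <= (m.+1%:R^-1 * ball_mass nu i (s i))%:E)%E.
  rewrite /ball_mass minr_pMr ?invr_ge0// mulr1 mulKf//.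
  rewrite EFin_min le_min fineK ?fin_num_measure//; apply/andP; split.
    apply: (@le_trans _ _ (P [set x i (s i) : borel X])).
      have [_ <-] := cpl _ (closed1 (x i (s i))).
      apply: le_measure; rewrite ?inE//; first exact: msnd.
      exact: subIsetr.
    rewrite PE (bigD1 i)//= big1 ?adde0; last first.
      move=> j ji; rewrite diracE memNset//= => xji.
      have := @sep j (s j) i (s i); rewrite xpair_eqE (negbTE ji)/= xji.
      by rewrite mdistxx => /(_ isT); rewrite ltNge ltW.
    by rewrite diracE mem_set// mule1.
  have [<- _] := cpl _ (mB i (s i)).
  by apply: le_measure; rewrite ?inE//; [exact: mfst|exact: subIsetl].
have mfar := measurable_far_pairs cptX (eps / 2).
have mnS : measurable (snd @^-1` (~` S) : set (borel X * borel X)).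
  by apply: msnd; exact: measurableC.
have mUC : measurable (\bigcup_i C i).
  by apply: fin_bigcup_measurable => //; exact: finite_finset.
have cov : (1 <= pi (far_pairs (eps / 2)) +
    (pi (snd @^-1` (~` S)) + \sum_i pi (C i)))%E.
  rewrite -(probability_setT pi).
  have -> : [set: borel X * borel X] =
      far_pairs (eps / 2) `|` (snd @^-1` (~` S) `|` \bigcup_i C i).
    apply/seteqP; split=> // -[y z] _.
    have [yz|yz] := ltP (eps / 2) (mdist (y : X) (z : X)); [by left|right].
    have [[i _ /= zi]|Sz] := pselect (S z); [right|by left].
    by exists i => //; split => //=; rewrite /B/= -zi.
  apply: (le_trans (measureU2 _ _ _)) => //; first exact: measurableU.
  apply: leeD2l; apply: (le_trans (measureU2 _ _ _)) => //.
  by apply: leeD2l; exact: measure_le_sum_finType.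
have nS0 : pi (snd @^-1` (~` S)) = 0%E.
  exact: etrans (cpl _ (measurableC mS)).2 PS.
have : (1 <= (8^-1)%:E + \sum_i (m.+1%:R^-1 * ball_mass nu i (s i))%:E)%E.
  apply: (le_trans cov); rewrite nS0 add0e; apply: leeD => //.
  by apply: lee_sum => i _.
rewrite sumEFin -EFinD lee_fin -mulr_sumr -lerBlDl ler_pdivlMl//.
by move=> h; apply: le_trans h; rewrite mulrC; lra.
Qed.

End one_coupling.

(** If n measures nu_t form a cover, each of the 2^m choices s is good for some
t, while each t is good for at most 2^m e^(-m/8) of them. *)
Lemma covering_number_wasserstein_ge (eps p : R) N : 0 < eps -> 1 <= p ->
    (2 <= N)%N ->
    (N%:R%:E <= covering_number (@metric_dist R X) eps)%E ->
  ((expR (N%:R / 32))%:E <= covering_number (@wasserstein R X p) (eps / 32))%E.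
Proof.
move=> eps0 p1 N2 ND.
have [y ysep] := separated_sequence eps0 ND.
have [m mN] : exists m, N./2 = m.+1.
  by case: N N2 {ND ysep} => [|[|N]]// _; exists N./2.
(* The pairs are y (2 i), y (2 i + 1); a last unpaired point is dropped. *)
pose x (i : 'I_m.+1) (b : bool) : X := y (i.*2 + b)%N.
have sep i b j c : (i, b) != (j, c) -> eps < mdist (x i b) (x j c).
  move=> ibjc.
  have lt (k : 'I_m.+1) (d : bool) : (k.*2 + d < N)%N.
    rewrite (@leq_trans (N./2).*2)//; last first.
      by rewrite -{2}(odd_double_half N) leq_addl.
    rewrite mN; apply: (@leq_trans (k.+1).*2); last by rewrite leq_double.
    by rewrite doubleS; case: d; rewrite ?addn1 ?addn0.
  have [ij|ij|ij] := ltngtP (i.*2 + b)%N (j.*2 + c)%N.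
  - by apply: ysep; rewrite ij lt.
  - by rewrite metric_sym; apply: ysep; rewrite ij lt.
  - move/negP: ibjc; case; rewrite xpair_eqE.
    have bc : b = c.
      have := congr1 odd ij; rewrite !oddD !odd_double/=.
      by case: (b); case: (c).
    by move: ij; rewrite bc => /addIn/double_inj/val_inj ->; rewrite !eqxx.
have /choice[P PE] : forall s : {ffun 'I_m.+1 -> bool},
    exists P : probability (borel X) R,
    forall A, P A = (m.+1%:R^-1%:E * \sum_i \d_(x i (s i) : borel X) A)%E.
  by move=> s; exact: (uniform_probability (fun i => x i (s i) : borel X)).
rewrite leNgt; apply/negP => /covering_number_lt[n [F [nE cov]]].
pose S t := [set s : {ffun 'I_m.+1 -> bool} |
  7 / 8 * m.+1%:R <= \sum_i ball_mass x eps (F t) i (s i)]%SET.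
have SE t : #|S t|%:R <= 2 ^+ m.+1 * expR (- (m.+1%:R / 8)) :> R.
  apply: card_large_sums_le; first by move=> i b; exact: ball_mass_01.
  exact: sum_ball_mass.
have : (2 ^ m.+1 <= \sum_t #|S t|)%N.
  have <- : #|{ffun 'I_m.+1 -> bool}| = (2 ^ m.+1)%N.
    by rewrite card_ffun card_bool card_ord.
  rewrite -sum1_card; under [leqRHS]eq_bigr do rewrite -sum1_card big_mkcond/=.
  rewrite exchange_big/=; apply: leq_sum => s _.
  have [t st] := cov (P s); rewrite (bigD1 t)//= ifT ?leq_addr// inE.
  exact: (ball_mass_coupling eps0 p1 sep (PE s) st).
rewrite -(ler_nat R) natr_sum natrX => lb.
have : 2 ^+ m.+1 <= n%:R * (2 ^+ m.+1 * expR (- (m.+1%:R / 8))) :> R.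
  apply: (le_trans lb); rewrite -[n in leRHS]card_ord mulr_natl -sumr_const.
  exact: ler_sum.
rewrite mulrCA ler_pMr ?exprn_gt0// expRN ler_pdivlMr ?expR_gt0// mul1r => en.
have : expR (m.+1%:R / 8) < expR (N%:R / 32) :> R.
  by apply: le_lt_trans en _; rewrite lte_fin in nE.
rewrite ltr_expR; apply/negP; rewrite -leNgt.
have : (N <= 4 * m.+1)%N.
  rewrite -mN -{1}(odd_double_half N) -muln2.
  by case: (odd N); move: N2 mN; lia.
rewrite -(ler_nat R) natrM; lra.
Qed.

End lower_bound.

(** * Rounding a measure to a finite set of points *)

Section quantization.
Context {R : realType} d (T : measurableType d).
Variable mu : probability T R.

Lemma measurable_pair_cst (z : T) : measurable_fun setT (fun y : T => (z, y)).
Proof. exact: measurable_fun_pair. Qed.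

(** The transport plan that sends a proportion c of the restriction of mu to A
to the point z; the target comes first in the pairs. *)
Lemma transport_piece (A : set T) (c : R) (z : T) : measurable A -> 0 <= c ->
  exists m : {measure set (T * T) -> \bar R},
    forall C, m C = (c%:E * mu ([set y | C (z, y)] `&` A))%E.
Proof.
move=> mA c0.
pose m0 : {measure set T -> \bar R} := mscale (NngNum c0) (mrestr mu mA).
have mf := measurable_pair_cst z.
by unshelve eexists (pushforward m0 (fun y : T => (z, y))).
Qed.

Lemma measure_sum n (m : 'I_n.+1 -> {measure set (T * T) -> \bar R}) :
  exists m' : {measure set (T * T) -> \bar R},
    forall C, m' C = (\sum_i m i C)%E.
Proof.
exists (msum (fun k => m (inord k)) n.+1) => C; rewrite /msum.
by apply: eq_bigr => i _; rewrite inord_val.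
Qed.

(** The mass w i out of A i goes to z i and the rest to z0.  In every cell the
same proportion is taken everywhere, as mu may have atoms heavier than w i. *)
Lemma quantized_coupling n (A : 'I_n.+1 -> set T) (w : 'I_n.+1 -> R)
    (z : 'I_n.+1 -> T) (z0 : T) :
    (forall i, measurable (A i)) -> trivIset setT A -> \bigcup_i A i = setT ->
    (forall i, 0 <= w i <= fine (mu (A i))) ->
  exists pi : probability (T * T)%type R,
  [/\ forall B, measurable B -> pi (snd @^-1` B) = mu B,
      forall B, pi (fst @^-1` B) =
        (\sum_i (w i)%:E * \d_(z i) B + (1 - \sum_i w i)%:E * \d_z0 B)%E &
      forall E, (forall i y, A i y -> ~ E (z i, y)) -> measurable E ->
        (pi E <= (1 - \sum_i w i)%:E)%E].
Proof.
move=> mA tA cA w01.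
pose a i := fine (mu (A i)).
have aE i : mu (A i) = (a i)%:E by rewrite /a fineK ?fin_num_measure.
have a0 i : 0 <= a i by rewrite /a fine_ge0.
pose c i := w i / a i.
(* This also holds in a null cell, where c i = 0 by the convention for
   division by 0 and w i = 0. *)
have ca i : c i * a i = w i.
  rewrite /c; have [ai0|ai0] := eqVneq (a i) 0; last by rewrite divfK.
  have := w01 i; rewrite -/(a i) ai0 mulr0 => /andP[? ?].
  by apply/eqP; rewrite eq_le; apply/andP.
have c0 i : 0 <= c i by rewrite divr_ge0//; have /andP[] := w01 i.
have c1 i : 0 <= 1 - c i.
  rewrite subr_ge0 /c; have [ai0|ai0] := eqVneq (a i) 0.
    by rewrite ai0 invr0 mulr0.
  rewrite ler_pdivrMr ?mul1r; first by have /andP[] := w01 i.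
  by rewrite lt_neqAle eq_sym ai0 a0.
have sum_mu B : measurable B -> (\sum_i mu (B `&` A i))%E = mu B.
  move=> mB; rewrite -measure_bigcup_finType.
  - by rewrite -setI_bigcupr cA setIT.
  - by move=> i; exact: measurableI.
  - exact: trivIset_setIl.
have sum_a : \sum_i a i = 1.
  apply: EFin_inj; rewrite -sumEFin -(probability_setT mu) -[RHS]sum_mu//.
  by apply: eq_bigr => i _; rewrite setTI aE.
have /choice[m1 m1E] := fun i => transport_piece (z i) (mA i) (c0 i).
have /choice[m2 m2E] := fun i => transport_piece z0 (mA i) (c1 i).
have [s1 s1E] := measure_sum m1.
have [s2 s2E] := measure_sum m2.
pose m : {measure set (T * T) -> \bar R} := measure_add s1 s2.
have mE C : m C = (\sum_i (c i)%:E * mu ([set y | C (z i, y)] `&` A i) +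
    \sum_i (1 - c i)%:E * mu ([set y | C (z0, y)] `&` A i))%E.
  transitivity (s1 C + s2 C)%E; first exact: measure_addE.
  rewrite s1E s2E; congr (_ + _)%E.
    by apply: eq_bigr => i _.
  by apply: eq_bigr => i _.
have sum_c : \sum_i (1 - c i) * a i = 1 - \sum_i w i.
  under eq_bigr do rewrite mulrBl mul1r ca.
  by rewrite sumrB sum_a.
have m_snd B : measurable B -> m (snd @^-1` B) = mu B.
  move=> mB; rewrite mE -big_split/= -[RHS]sum_mu//.
  apply: eq_bigr => i _; rewrite -ge0_muleDl ?lee_fin// -EFinD.
  by rewrite addrC subrK mul1e.
have slice_fst (x : T) B i :
    mu ([set y | (fst @^-1` B) (x, y)] `&` A i) = ((a i)%:E * \d_x B)%E.
  rewrite diracE; have [xB|xB] := boolP (x \in B).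
    rewrite mule1 -aE; congr (mu _); apply/seteqP; split=> y; first by case.
    by move=> ?; split => //=; rewrite inE in xB.
  rewrite mule0 (_ : _ `&` _ = set0) ?measure0//.
  by apply/seteqP; split=> y //= [/mem_set]; rewrite (negbTE xB).
have m1T : m setT = 1%E.
  by rewrite -(probability_setT mu) -m_snd// preimage_setT.
have [pi piE] := measure_is_probability \d_(z0, z0) m1T.
exists pi; split.
- by move=> B mB; rewrite piE m_snd.
- move=> B; rewrite piE mE; congr (_ + _)%E.
    by apply: eq_bigr => i _; rewrite slice_fst muleA -EFinM ca.
  rewrite -sum_c -sumEFin ge0_sume_distrl => [|i _]; last first.
    by rewrite lee_fin mulr_ge0.
  by apply: eq_bigr => i _; rewrite slice_fst muleA -EFinM.
- move=> E EA mEE; rewrite piE mE big1 ?add0e => [|i _].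
    rewrite -sum_c -sumEFin; apply: lee_sum => i _.
    rewrite EFinM -aE lee_wpmul2l ?lee_fin//; apply: le_measure; rewrite ?inE//.
    apply: measurableI => //; rewrite -[X in measurable X]setTI.
    exact: (measurable_pair_cst z0).
  rewrite (_ : _ `&` _ = set0) ?measure0 ?mule0//.
  by apply/seteqP; split=> y //= [? ?]; apply: (EA i y).
Qed.

End quantization.

Lemma first_marginal {R : realType} d (T : measurableType d)
    (pi : probability (T * T)%type R) :
  exists nu : probability T R, forall B, nu B = pi (fst @^-1` B).
Proof.
have [m mE] : exists m : {measure set T -> \bar R},
    forall B, m B = pi (fst @^-1` B).
  by unshelve eexists (pushforward pi (fst : T * T -> T)).
have m1 : m setT = 1%E by rewrite mE preimage_setT probability_setT.
have [nu nuE] := measure_is_probability \d_point m1.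
by exists nu => B; rewrite nuE mE.
Qed.

(** * Upper bound for the covering numbers of the probability measures *)

Section upper_bound.
Context {R : realType} (X : pointedMetricType R) (cptX : compact [set: X]).

(** Each point is assigned to the first ball of the cover that contains it. *)
Lemma finite_cover_partition (eps : R) n (f : 'I_n -> X) :
    (forall y, exists i, (metric_dist (f i) y <= eps%:E)%E) ->
  exists A : 'I_n -> set (borel X),
  [/\ forall i, measurable (A i), trivIset setT A, \bigcup_i A i = setT &
      forall i y, A i y -> mdist (f i) (y : X) <= eps].
Proof.
move=> cov.
pose B i : set (borel X) := [set y | mdist (y : X) (f i) <= eps].
have mB i : measurable (B i).
  have := measurable_mdistr (f i) measurableT (measurable_itv `]-oo, eps]%R).
  by rewrite setTI.
exists (fun i => B i `\` \bigcup_(j in [set j : 'I_n | (j < i)%N]) B j); split.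
- move=> i; apply: measurableD => //; apply: fin_bigcup_measurable => [|j _].
    exact: finite_finset.
  exact: mB.
- move=> i j _ _ [y [[yi ni] [yj nj]]]; apply/val_inj/eqP.
  case: ltngtP => // ij; first by case: nj; exists i.
  by case: ni; exists j.
- apply/seteqP; split=> // y _.
  have [i0 yi0] : exists i, B i y.
    by have [i] := cov y; rewrite lee_fin metric_sym; exists i.
  have [i] :=
    @arg_minnP _ i0 (fun i => `[< B i y >]) (@nat_of_ord n) (asboolT yi0).
  move=> /asboolP yi imin; exists i => //; split => // -[j /= ji yj].
  by have := imin j (asboolT yj); rewrite leqNgt ji.
- by move=> i y [yi _]; rewrite metric_sym.
Qed.

(** The cells of mu have masses with integer parts g mu in units of 1/k.  The
rounded measure depends on g mu alone, so one centre for each value of g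
suffices. *)
Lemma covering_number_wasserstein_le (p D eps : R) n k (f : 'I_n -> X) :
    1 <= p -> 0 < eps -> (0 < k)%N ->
    0 <= D -> (forall x y : X, mdist x y <= D) ->
    (forall y, exists i, (metric_dist (f i) y <= eps%:E)%E) ->
    n%:R * D `^ p <= k%:R * eps `^ p ->
  (covering_number (@wasserstein R X p) (2 * eps) <= (k.+1%:R ^+ n)%:E)%E.
Proof.
case: n f => [|n] f p1 eps0 k0 D0 dD cov nk; first by have [[]] := cov point.
have [A [mA tA cA Af]] := finite_cover_partition cov.
have kR : 0 < k%:R :> R by rewrite ltr0n.
pose g (mu : probability (borel X) R) : {ffun 'I_n.+1 -> 'I_k.+1} :=
  [ffun i => inord (Num.truncn (k%:R * fine (mu (A i))))].
pose w (t : {ffun 'I_n.+1 -> 'I_k.+1}) i : R := (t i)%:R / k%:R.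
have gE mu i : w (g mu) i <= fine (mu (A i)) < w (g mu) i + k%:R^-1.
  have a0 : 0 <= fine (mu (A i)) by rewrite fine_ge0.
  have a1 : fine (mu (A i)) <= 1.
    by rewrite -lee_fin fineK ?fin_num_measure// probability_le1.
  have ka0 : 0 <= k%:R * fine (mu (A i)) by rewrite mulr_ge0// ltW.
  have /andP[lo hi] := truncn_itv ka0.
  rewrite /w ffunE inordK; last first.
    rewrite ltnS -(ler_nat R) (le_trans lo)// ler_piMr// ltW.
  apply/andP; split; first by rewrite ler_pdivrMr// [leRHS]mulrC.
  by rewrite -[X in _ + X]mul1r -mulrDl ltr_pdivlMr// natr1 [ltLHS]mulrC.
have w0 t i : 0 <= w t i by rewrite divr_ge0.
have coupled (mu : probability (borel X) R) :
  exists pi : probability (borel X * borel X)%type R,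
  [/\ forall B, measurable B -> pi (snd @^-1` B) = mu B,
      forall B, pi (fst @^-1` B) =
        (\sum_i (w (g mu) i)%:E * \d_(f i : borel X) B +
         (1 - \sum_i w (g mu) i)%:E * \d_(point : borel X) B)%E &
      (pi (far_pairs eps) * (D `^ p)%:E <= (eps `^ p)%:E)%E].
  have [|pi [pi2 pi1 far]] := @quantized_coupling _ _ _ mu n A (w (g mu))
      (fun i => f i : borel X) (point : borel X) mA tA cA.
    by move=> i; have /andP[-> _] := gE mu i; rewrite w0.
  exists pi; split => //.
  have {}far : (pi (far_pairs eps) <= (n.+1%:R / k%:R)%:E)%E.
    apply: (le_trans (far (far_pairs eps) _ _)).
    - by move=> i y /Af; rewrite leNgt => /negP.
    - exact: measurable_far_pairs.
    rewrite lee_fin.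
    have sum_a : \sum_i fine (mu (A i)) = 1.
      apply: EFin_inj; rewrite -sumEFin -(probability_setT mu) -cA.
      rewrite measure_bigcup_finType//.
      by apply: eq_bigr => i _; rewrite fineK ?fin_num_measure.
    rewrite -[X in X - _]sum_a -sumrB mulr_natl.
    rewrite -[n.+1 in leRHS]card_ord -sumr_const.
    apply: ler_sum => i _; have /andP[_ /ltW] := gE mu i.
    by rewrite -lerBlDl.
  apply: (@le_trans _ _ ((n.+1%:R / k%:R)%:E * (D `^ p)%:E)%E).
    by apply: lee_wpmul2r far; rewrite lee_fin powR_ge0.
  by rewrite -EFinM lee_fin mulrAC ler_pdivrMr// mulrC [leRHS]mulrC mulrC.
have /choice[F FP] : forall t, exists nu : probability (borel X) R,
    forall mu, g mu = t -> (wasserstein p nu mu <= (2 * eps)%:E)%E.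
  move=> t; have [[mu0 mu0t]|nt] := pselect (exists mu0, g mu0 = t); last first.
    by exists (\d_(point : borel X)) => mu mut; case: nt; exists mu.
  have [pi0 [_ pi0E _]] := coupled mu0.
  have [nu nuE] := first_marginal pi0.
  exists nu => mu mut; have [pi [pi2 pi1 far]] := coupled mu.
  apply: (wasserstein_le cptX p1 eps0 dD D0 _ far) => B mB; split.
    by rewrite nuE pi0E mu0t -mut -pi1.
  exact: pi2.
have <- : #|{ffun 'I_n.+1 -> 'I_k.+1}|%:R = k.+1%:R ^+ n.+1 :> R.
  by rewrite card_ffun !card_ord natrX.
apply: (covering_number_le (f := F)) => mu; exists (g mu); exact: FP.
Qed.

End upper_bound.

(** * Metric order of the space of probability measures *)

Local Open Scope ereal_scope.

Theorem theorem1p3 (R : realType) (X : pointedMetricType R) (p : R)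
    (cptX : compact [set: X]) (p_ge1 : (1 <= p)%R) :
  [/\ lower_box_dim (@metric_dist R X) <= lower_metric_order (@wasserstein R X p),
      lower_metric_order (@wasserstein R X p)
        <= upper_metric_order (@wasserstein R X p)
    & upper_metric_order (@wasserstein R X p) <= upper_box_dim (@metric_dist R X)]
  /\ (forall s : \bar R, has_box_dim (@metric_dist R X) s ->
        has_metric_order (@wasserstein R X p) s).
Proof.
have lower : lower_box_dim (@metric_dist R X) <=
    lower_metric_order (@wasserstein R X p).
  have c1 : (1 <= 32 :> R)%R by rewrite ler1n.
  apply: (lower_box_dim_le_metric_order
    (point : probability (borel X) R) c1 c1).
  by move=> eps N eps0 N2; exact: covering_number_wasserstein_ge.
have middle : lower_metric_order (@wasserstein R X p) <=
  upper_metric_order (@wasserstein R X p) by exact: limf_einf_le_esup.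
have upper : upper_metric_order (@wasserstein R X p) <=
    upper_box_dim (@metric_dist R X).
  have [D D1 dD] := bounded_mdist cptX.
  have D0 : (0 <= D)%R by exact: le_trans D1.
  have Dp1 : (1 <= D `^ p)%R by exact: le_trans D1 (le1r_powR D1 p_ge1).
  apply: (upper_metric_order_le_box_dim (point : X) Dp1 p_ge1).
  by move=> eps n k f eps0 k0 cov; exact: covering_number_wasserstein_le.
split=> // s [lo up]; split; apply/eqP; rewrite eq_le; apply/andP; split.
- by rewrite (le_trans middle)// -up.
- by rewrite -lo.
- by rewrite -up.
- by rewrite -[leLHS]lo (le_trans lower).
Qed.
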